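(* Let $H$ be a non-trivial finite group and let $a_1,c_1,a_2,c_2$ be elements of $H$. Assume that 1. the orders of $a_1$ and $c_1$ are even; 2. $a_1^2,\ a_1c_1,\ c_1^2$ generate $H$; 3. $a_2,c_2$ generate $H$; 4. $\nu(a_1,c_1)$ is coprime to $\nu(a_2,c_2)$. Set $G=H_{[4]}$, $G^0=H_{[2]}$, $a=(a_1,a_2,2)$ and $c=(c_1,c_2,2)$. Then $(G^0;a,c)$ is a mixed Beauville structure on $G$. If $H$ is a perfect group, then the conclusion holds with hypothesis 2 replaced by the hypothesis 2'. $a_1,c_1$ generate $H$.
   Context: For elements $a,c$ of a finite group, $\nu(a,c)=\mathrm{ord}(a)\,\mathrm{ord}(c)\,\mathrm{ord}(ac)$. Let $\Theta(g,h)=(h,g)$ on $H\times H$. $H_{[4]}=(H\times H)\rtimes\mathbb{Z}/4\mathbb{Z}$, where the generator $1$ of $\mathbb{Z}/4\mathbb{Z}$ acts through $\Theta$, and $H_{[2]}=H\times H\times 2\mathbb{Z}/4\mathbb{Z}\cong H\times H\times\mathbb{Z}/2\mathbb{Z}$, a subgroup of index $2$ in $H_{[4]}$. For a finite group $K$ and $a,c\in K$ put $\Sigma(a,c)=\bigcup_{g\in K}\bigcup_{i\ge 0}\{ga^ig^{-1},\,gc^ig^{-1},\,g(ac)^ig^{-1}\}$. A mixed Beauville structure on a nontrivial finite group $G$ is a triple $(G^0;a,c)$, with $G^0\le G$ of index $2$ and $a,c\in G^0$, for which there is $g\in G$ such that: (1) $G^0=\langle a,c\rangle$; (2) $g\notin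 G^0$; (3) $g\gamma g\gamma\notin\Sigma(a,c)$ for every $\gamma\in G^0$; (4) $\Sigma(a,c)\cap\Sigma(gag^{-1},gcg^{-1})=\{1_G\}$; here $\Sigma$ is formed in $G^0$. *)

(* Defs.v *)
From mathcomp Require Import all_boot all_algebra all_fingroup all_solvable.
Set Implicit Arguments.
Unset Strict Implicit.
Unset Printing Implicit Defensive.
Import GroupScope.

Definition nu (gT : finGroupType) (a c : gT) : nat :=
  (#[a] * #[c] * #[a * c])%N.

(* MathComp's [x ^ y] is y^-1 x y, so conjugation on the left is written out. *)
Definition lconj (gT : finGroupType) (g x : gT) : gT := g * x * g^-1.

(* In a finite group the cycle <[x]> is the set of the powers x^i, i >= 0;
   see [SigmaP]. *)
Definition Sigma (gT : finGroupType) (K : {group gT}) (a c : gT) : {set gT} :=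
  \bigcup_(g in K) [set lconj g x | x in <[a]> :|: <[c]> :|: <[a * c]>].

Lemma SigmaP (gT : finGroupType) (K : {group gT}) (a c x : gT) :
  reflect (exists2 g, g \in K & exists i : nat,
             [\/ x = g * a ^+ i * g^-1,
                 x = g * c ^+ i * g^-1 |
                 x = g * (a * c) ^+ i * g^-1])
          (x \in Sigma K a c).
Proof.
apply: (iffP bigcupP) => [[g Kg /imsetP[y]] | [g Kg [i Hx]]].
  rewrite !inE -orbA => /or3P[] /cycleP[i ->] ->; exists g => //; exists i.
  - by apply: Or31.
  - by apply: Or32.
  - by apply: Or33.
exists g => //.
by case: Hx => ->; apply: (imset_f (lconj g)); rewrite !inE mem_cycle ?orbT.
Qed.

(* The triple (G0; a, c) is a mixed Beauville structure on the group G. *)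
Definition mixed_Beauville (gT : finGroupType) (G G0 : {group gT})
    (a c : gT) : Prop :=
  [/\ G :!=: 1, G0 \subset G, #|G : G0| = 2, a \in G0 & c \in G0] /\
  exists2 g, g \in G &
    [/\ G0 :=: <<[set a; c]>>,
        g \notin G0,
        {in G0, forall y, g * y * g * y \notin Sigma G0 a c} &
        Sigma G0 a c :&: Sigma G0 (lconj g a) (lconj g c) = [set 1]].

Section Swap.

Variable H : finGroupType.

Definition Theta (x : H * H) : H * H := (x.2, x.1).

(* 'Z_4 is written multiplicatively when it is used as a group. *)
Definition Theta_iter (x : H * H) (k : 'Z_4) : H * H := iter k Theta x.

Lemma Theta_iterE x k : Theta_iter x k = if odd k then Theta x else x.
Proof. by case: k x => [[|[|[|[|//]]]] ?] [? ?]. Qed.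

Lemma Theta_iter1 : Theta_iter^~ 1 =1 id.
Proof. by []. Qed.

Lemma Theta_iterM x : act_morph Theta_iter x.
Proof.
by case: x => [x1 x2] [[|[|[|[|//]]]] ?] [[|[|[|[|//]]]] ?].
Qed.

Definition Theta_act : {action 'Z_4 &-> H * H} :=
  TotalAction Theta_iter1 Theta_iterM.

Lemma Theta_act_is_groupAction : is_groupAction [set: H * H] Theta_act.
Proof.
move=> k _; rewrite inE; apply/andP; split; first by apply/subsetP=> x; rewrite inE.
apply/morphicP => x y _ _; rewrite !actpermE /= !Theta_iterE.
by case: ifP.
Qed.

Definition Theta_gact : groupAction [set: 'Z_4] [set: H * H] :=
  GroupAction Theta_act_is_groupAction.

(* The group H_[4]. *)
Definition wr4 : finGroupType := sdprod_by Theta_gact.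

(* The element (h1, h2, k) of H_[4]. *)
Definition elt4 (h1 h2 : H) (k : 'Z_4) : wr4 :=
  sdpair1 Theta_gact (h1, h2) * sdpair2 Theta_gact k.

Lemma elt4M (h1 h2 h1' h2' : H) (k k' : 'Z_4) :
  elt4 h1 h2 k * elt4 h1' h2' k' =
  let: (u1, u2) := iter k Theta (h1', h2') in
  elt4 (h1 * u1) (h2 * u2) (k + k')%R.
Proof.
have swap : sdpair2 Theta_gact k * sdpair1 Theta_gact (h1', h2') =
            sdpair1 Theta_gact (Theta_iter (h1', h2') k) * sdpair2 Theta_gact k.
  rewrite [RHS]conjgC -sdpair_act ?inE //=; congr (_ * sdpair1 _ _).
  by rewrite !Theta_iterE; case: (odd k).
rewrite /elt4 -mulgA [X in _ * X]mulgA swap /Theta_iter.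
case: (iter k Theta _) => u1 u2.
rewrite -mulgA -morphM ?inE // mulgA -morphM ?inE //.
Qed.

(* The subset H x H x 2Z/4Z of H_[4]. *)
Definition wr2_set : {set wr4} :=
  [set elt4 x.1 x.2 k | x in [set: H * H], k in <[2%:R%R : 'Z_4]>].

Lemma group_set_wr2 : group_set wr2_set.
Proof.
apply/group_setP; split.
  apply/imset2P; exists (1, 1) (1 : 'Z_4); rewrite ?inE ?group1 //=.
  by rewrite /elt4 -[(1, 1)]/(1 : (H * H)%type) !morph1 mulg1.
move=> _ _ /imset2P[[x1 x2] k _ Hk ->] /imset2P[[y1 y2] l _ Hl ->].
rewrite /= elt4M; case: (iter k Theta _) => u1 u2.
by apply/imset2P; exists (x1 * u1, x2 * u2) (k * l); rewrite ?inE ?groupM.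
Qed.

(* The group H_[2]. *)
Definition wr2 : {group wr4} := Group group_set_wr2.

End Swap.

(* Main.v *)
Require Import Defs.
From mathcomp Require Import all_boot all_algebra all_fingroup all_solvable.
Import GroupScope.

(** The orders occurring in [nu a1 c1] are coprime to those occurring in
    [nu a2 c2], and since [#[a1]] and [#[c1]] are even, the latter are all odd.
    Write Z/4Z multiplicatively, with generator [t] and involution [two], and
    let [a = (a1, a2, two)], [c = (c1, c2, two)].

    Generation. A power [a ^+ i] whose exponent is 1 modulo [#[a1]] and 0 modulo
    [#[a2]] is [(a1, 1, two)], and exchanging the two moduli gives [(1, a2, 1)];
    likewise for [c] ([split_factors]). So [<<a, c>>] contains the second factor
    [H], and the products of two of [(a1, 1, two)], [(c1, 1, two)], whose last
    coordinates cancel, give [a1 ^+ 2], [a1 * c1], [c1 ^+ 2] in the first factor.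
    These generate it by hypothesis, and then [(1, 1, two)] is obtained as well
    ([gen_wr2]).

    Conditions on [Sigma]. Everything follows from one invariant of an element
    [(x, y, k)] of [Sigma a c] ([Sigma_elt4]): the order of [x] divides
    [nu a1 c1], that of [y] divides [nu a2 c2], and if [k] is not 1 then [x] has
    even order. Take [g = (1, 1, t)]. For [y = (u, v, k)] in the index 2 subgroup,
    [(g * y) ^+ 2 = (v * u, u * v, two)]; the conjugate elements [v * u] and
    [u * v] have the same order, which the invariant would force to be both even
    and odd. Conjugation by [g] swaps the two factors, so an element [(x, y, k)]
    of both sets in the last condition has [x] and [y] of orders dividing
    coprime numbers; they are trivial, and then [k] is 1 because 1 has odd order.

    Perfect groups. If [a1], [c1] generate [H], then modulo the normal subgroup
    generated by [a1 ^+ 2], [a1 * c1], [c1 ^+ 2] the group [H] is cyclic, so this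
    subgroup contains the derived subgroup of [H] ([der1_sub_even_words]). *)

(** * Orders and generation in finite groups *)

Lemma lconjE (gT : finGroupType) (g z : gT) : lconj g z = z ^ g^-1.
Proof. by rewrite /lconj conjgE invgK mulgA. Qed.

Lemma order_mulC (gT : finGroupType) (x y : gT) : #[x * y] = #[y * x].
Proof. by rewrite -(orderJ (y * x) y) conjgE mulgA mulKg. Qed.

Lemma even_orderX (gT : finGroupType) (x : gT) i :
  odd i -> ~~ odd #[x] -> ~~ odd #[x ^+ i].
Proof.
move=> i_odd; rewrite -!dvdn2 => x_even.
have: 2 %| i * #[x ^+ i].
  by apply: dvdn_trans x_even _; rewrite order_dvdn expgM expg_order.
by rewrite Gauss_dvdr // coprime2n.
Qed.

Lemma dvdn_coprime_order (gT : finGroupType) (x : gT) m n :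
  coprime m n -> #[x] %| m -> #[x] %| n -> x = 1.
Proof.
move=> co_mn x_m x_n; apply/eqP; rewrite -order_eq1 -dvdn1.
by rewrite -(eqP co_mn) dvdn_gcd x_m.
Qed.

Lemma Sigma1 (gT : finGroupType) (K : {group gT}) (a c : gT) :
  1 \in Sigma K a c.
Proof.
by apply/SigmaP; exists 1 => //; exists 0;
  apply: Or31; rewrite expg0 mulg1 mulgV.
Qed.

Lemma gen_preim (gT rT : finGroupType) (f : {morphism [set: gT] >-> rT})
    (M : {group rT}) (S : {set gT}) :
  <<S>> = [set: gT] -> {in S, forall x, f x \in M} -> forall x, f x \in M.
Proof.
move=> genS fS x.
have: <<S>> \subset f @*^-1 M.
  by rewrite gen_subG; apply/subsetP=> y /fS fy; rewrite !inE.
by move/subsetP/(_ x); rewrite genS !inE => /(_ isT).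
Qed.

(** The subgroup [K] of words of even length in [x] and [y] is normal, and
    [y] is [x^-1] modulo [K], so the quotient by [K] is cyclic. *)
Lemma der1_sub_even_words (gT : finGroupType) (x y : gT) :
  <<[set x; y]>> = [set: gT] ->
  [~: [set: gT], [set: gT]] \subset <<[set x ^+ 2; x * y; y ^+ 2]>>.
Proof.
move=> gen_xy; pose K := [group of <<[set x ^+ 2; x * y; y ^+ 2]>>];
  rewrite -[<<_>>]/(K : {set gT}).
have Kxx : x ^+ 2 \in K by apply: mem_gen; rewrite !inE eqxx.
have Kxy : x * y \in K by apply: mem_gen; rewrite !inE eqxx orbT.
have Kyy : y ^+ 2 \in K by apply: mem_gen; rewrite !inE eqxx !orbT.
have Kyx : y * x \in K.
  have -> : y * x = y ^+ 2 * (x * y)^-1 * x ^+ 2.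
    by rewrite !expgS !expg0 !mulg1 invMg !mulgA mulgK mulgKV.
  exact: groupM (groupM Kyy (groupVr Kxy)) Kxx.
have nK : [set: gT] \subset 'N(K).
  rewrite -gen_xy gen_subG; apply/subsetP=> z; rewrite !inE => /orP[] /eqP ->;
    rewrite -genJ gen_subG; apply/subsetP=> _ /imsetP[w + ->];
    rewrite !inE -orbA => /or3P[] /eqP ->.
  - by rewrite conjXg conjgE mulKg.
  - by rewrite conjgE -mulgA mulKg.
  - have -> : y ^+ 2 ^ x = (x ^+ 2)^-1 * (x * y) * (y * x).
      by rewrite conjgE !expgS !expg0 !mulg1 invMg !mulgA mulgKV.
    exact: groupM (groupM (groupVr Kxx) Kxy) Kyx.
  - have -> : x ^+ 2 ^ y = (y ^+ 2)^-1 * (y * x) * (x * y).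
      by rewrite conjgE !expgS !expg0 !mulg1 invMg !mulgA mulgKV.
    exact: groupM (groupM (groupVr Kyy) Kyx) Kxy.
  - have -> : (x * y) ^ y = (y ^+ 2)^-1 * (y * x) * y ^+ 2.
      by rewrite conjgE !expgS !expg0 !mulg1 invMg !mulgA mulgKV.
    exact: groupM (groupM (groupVr Kyy) Kyx) Kyy.
  by rewrite conjXg conjgE mulKg.
apply: (der1_min nK); rewrite -[X in X / K]/[set: gT].
have <- : K <*> <[x]> = [set: gT].
  apply/eqP; rewrite eqEsubset subsetT -gen_xy gen_subG.
  have Jx : x \in K <*> <[x]> by rewrite mem_gen // inE cycle_id orbT.
  apply/subsetP=> z; rewrite !inE => /orP[] /eqP -> //.
  by rewrite -(mulKg x y) groupM ?groupV // mem_gen // inE Kxy.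
rewrite quotientYidl ?quotient_abelian ?cycle_abelian //.
exact: subset_trans (subsetT _) nK.
Qed.

(** * The group H_[4] in coordinates *)

Section Elt4.

Variable H : finGroupType.
Implicit Types (x y u v : H) (k l : 'Z_4).

Local Notation two := (2%:R%R : 'Z_4).

Lemma two_two : two * two = 1.
Proof. exact: val_inj. Qed.

Lemma order_two : #[two] = 2.
Proof. by apply: nt_prime_order => //; apply: val_inj. Qed.

Lemma cycle_two : <[two]> = [set 1; two].
Proof. exact: cycle2g order_two. Qed.

Lemma odd_cycle_two k : k \in <[two]> -> odd k = false.
Proof. by rewrite cycle_two !inE => /orP[] /eqP ->. Qed.

Lemma mem_wr2 x y k : k \in <[two]> -> elt4 x y k \in wr2 H.
Proof. by move=> k2; apply/imset2P; exists (x, y) k. Qed.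

Lemma wr2P z :
  reflect (exists x y k, k \in <[two]> /\ z = elt4 x y k) (z \in wr2 H).
Proof.
apply: (iffP imset2P) => [[[x y] k _ k2 ->] | [x [y [k [k2 ->]]]]].
  by exists x, y, k.
by exists (x, y) k.
Qed.

Lemma elt4M_even x y k u v l :
  k \in <[two]> -> elt4 x y k * elt4 u v l = elt4 (x * u) (y * v) (k * l).
Proof.
by move/odd_cycle_two=> kE; rewrite elt4M -/(Theta_iter _ _) Theta_iterE kE.
Qed.

Lemma elt4_1 : elt4 1 1 1 = 1 :> wr4 H.
Proof. by rewrite /elt4 -[(1, 1)]/(1 : (H * H)%type) !morph1 mulg1. Qed.

Lemma elt4X x y k i :
  k \in <[two]> -> elt4 x y k ^+ i = elt4 (x ^+ i) (y ^+ i) (k ^+ i).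
Proof.
move=> k2; elim: i => [|i IHi]; first by rewrite !expg0 elt4_1.
by rewrite !expgS IHi elt4M_even.
Qed.

Lemma elt4V x y k :
  k \in <[two]> -> (elt4 x y k)^-1 = elt4 x^-1 y^-1 k^-1.
Proof.
move=> k2; apply: (mulgI (elt4 x y k)).
by rewrite elt4M_even // !mulgV elt4_1.
Qed.

Lemma lconj_elt4 u v k x y l : k \in <[two]> -> l \in <[two]> ->
  lconj (elt4 u v k) (elt4 x y l) = elt4 (lconj u x) (lconj v y) l.
Proof.
move=> k2 l2; rewrite /lconj elt4V // !elt4M_even ?groupM //.
by congr elt4; rewrite -mulgA [l * _]Zp_mulgC mulKVg.
Qed.

(** An element of the semidirect product is stored as the pair [(k, h)] standing
    for the product of [k] by [h] in this order, so the underlying second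
    component of [elt4 x y k] is [(x, y)] acted on by [k]. *)
Lemma elt4_inj : injective (fun p : H * H * 'Z_4 => elt4 p.1.1 p.1.2 p.2).
Proof.
move=> [[x y] k] [[u v] l] /= /(congr1 val).
rewrite /= !val_insubd !inE /= !mul1g !mulg1.
by case=> <- /(act_inj (Theta_act H) k)[-> ->].
Qed.

Lemma elt4_surj z : exists x y k, z = elt4 x y k.
Proof.
have [p [q [Gp Gq -> _]]] :=
  mem_sdprod (sdprod_sdpair (Theta_gact H)) (in_setT z).
have [[x y] _ _ ->] := morphimP Gp; have [k _ _ ->] := morphimP Gq.
by exists x, y, k.
Qed.

Lemma card_elt4 (A : {set 'Z_4}) :
  #|[set elt4 x.1 x.2 k | x in [set: H * H], k in A]| = (#|H| * #|H| * #|A|)%N.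
Proof.
rewrite curry_imset2X card_imset; last first.
  by move=> [[x y] k] [[u v] l]; apply: (@elt4_inj (x, y, k) (u, v, l)).
by rewrite [LHS]cardsX cardsT card_prod.
Qed.

Lemma index_wr2 : #|[set: wr4 H] : wr2 H| = 2.
Proof.
have HH_gt0 : (0 < #|H| * #|H|)%N by rewrite muln_gt0 andbb -cardsT cardG_gt0.
have cardG : #|[set: wr4 H]| = (#|H| * #|H| * 4)%N.
  have -> : [set: wr4 H] =
      [set elt4 x.1 x.2 k | x in [set: H * H], k in [set: 'Z_4]].
    apply/setP=> z; rewrite inE; apply/esym/imset2P.
    by have [x [y [k ->]]] := elt4_surj z; exists (x, y) k.
  by rewrite card_elt4 cardsT card_ord.
have cardG0 : #|wr2 H| = (#|H| * #|H| * 2)%N.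
  by rewrite [LHS]card_elt4 -orderE order_two.
by rewrite -divgS ?subsetT // cardG cardG0 divnMl.
Qed.

(** * The sets Sigma *)

(** The coordinates are conjugates of powers of those of the two generators or
    of their product. The product has trivial last coordinate, so a nontrivial
    [k] comes from an odd power of a generator, whose first coordinate inherits
    even order from [x1] or [y1]. Parity is a conditional conclusion because the
    lemma is also used with the factors exchanged, when [x1] and [y1] have odd
    order. *)
Lemma Sigma_elt4 (x1 x2 y1 y2 : H) z :
  z \in Sigma (wr2 H) (elt4 x1 x2 two) (elt4 y1 y2 two) ->
  exists u v k, [/\ z = elt4 u v k, #[u] %| nu x1 y1, #[v] %| nu x2 y2 &
    ~~ odd #[x1] -> ~~ odd #[y1] -> k != 1 -> ~~ odd #[u]].
Proof.
have two2 : two \in <[two]> by apply: cycle_id.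
have conjX p q u v k l i : k \in <[two]> -> l \in <[two]> ->
  elt4 u v k * elt4 p q l ^+ i * (elt4 u v k)^-1 =
    elt4 (lconj u (p ^+ i)) (lconj v (q ^+ i)) (l ^+ i).
  by move=> k2 l2; rewrite elt4X // -[LHS]/(lconj _ _) lconj_elt4 ?groupX.
have odd_exp i : two ^+ i != 1 -> odd i.
  by rewrite -order_dvdn order_two dvdn2 negbK.
case/SigmaP=> _ /wr2P[u [v [k [k2 ->]]]] [i].
rewrite elt4M_even // two_two.
case=> ->; rewrite conjX ?group1 //; do 3!eexists; split; try reflexivity;
  rewrite !lconjE !orderJ.
- by rewrite /nu -mulnA dvdn_mulr ?orderXdvd.
- by rewrite /nu -mulnA dvdn_mulr ?orderXdvd.
- by move=> x_even _ /odd_exp i_odd; apply: even_orderX.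
- by rewrite /nu mulnAC dvdn_mull ?orderXdvd.
- by rewrite /nu mulnAC dvdn_mull ?orderXdvd.
- by move=> _ y_even /odd_exp i_odd; apply: even_orderX.
- by rewrite /nu dvdn_mull ?orderXdvd.
- by rewrite /nu dvdn_mull ?orderXdvd.
by rewrite expg1n eqxx.
Qed.

(** * Generation of H_[2] *)

(** The Chinese remainder theorem provides a power that fixes one of [x] and [y]
    and kills the other. Since 2 divides [#[x]], the effect on the last
    coordinate is the same as on [x]. *)
Lemma split_factors (M : {group wr4 H}) x y :
  ~~ odd #[x] -> coprime #[x] #[y] -> elt4 x y two \in M ->
  elt4 x 1 two \in M /\ elt4 1 y 1 \in M.
Proof.
move=> x_even co_xy Mxy; have two2 : two \in <[two]> by apply: cycle_id.
have two_x i : two ^+ i = two ^+ (i %% #[x]).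
  rewrite -[RHS](expg_mod_order) -[LHS](expg_mod_order) order_two.
  by rewrite modn_dvdm ?dvdn2.
split.
  have := groupX (chinese #[x] #[y] 1 0) Mxy; rewrite elt4X //.
  rewrite two_x -[x ^+ _]expg_mod_order -[y ^+ _]expg_mod_order.
  by rewrite chinese_modl // chinese_modr // mod0n -two_x expg_mod_order.
have := groupX (chinese #[x] #[y] 0 1) Mxy; rewrite elt4X //.
rewrite two_x -[x ^+ _]expg_mod_order -[y ^+ _]expg_mod_order.
by rewrite chinese_modl // chinese_modr // mod0n expg_mod_order.
Qed.

Lemma elt4_left_morph :
  {in [set: H] &, {morph (fun x => elt4 x 1 1) : x y / x * y}}.
Proof. by move=> x y _ _; rewrite elt4M_even ?mulg1. Qed.

Lemma elt4_right_morph :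
  {in [set: H] &, {morph (fun y => elt4 1 y 1) : x y / x * y}}.
Proof. by move=> x y _ _; rewrite elt4M_even ?mulg1. Qed.

Lemma gen_wr2 (a1 c1 a2 c2 : H) :
  ~~ odd #[a1] -> ~~ odd #[c1] -> coprime (nu a1 c1) (nu a2 c2) ->
  <<[set a2; c2]>> = [set: H] ->
  <<[set a1 ^+ 2; a1 * c1; c1 ^+ 2]>> = [set: H] ->
  wr2 H :=: <<[set elt4 a1 a2 two; elt4 c1 c2 two]>>.
Proof.
move=> a1_even c1_even co_nu gen2 gen1.
have two2 : two \in <[two]> by apply: cycle_id.
have [co_a co_c] : coprime #[a1] #[a2] /\ coprime #[c1] #[c2].
  move: co_nu; rewrite /nu !coprimeMl !coprimeMr.
  by case/andP=> /andP[/andP[/andP[-> _] _] /andP[/andP[_ ->] _]] _.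
apply/eqP; rewrite eqEsubset; apply/andP; split; last first.
  by rewrite gen_subG; apply/subsetP=> z; rewrite !inE => /orP[] /eqP ->;
    apply: mem_wr2.
pose M := [group of <<[set elt4 a1 a2 two; elt4 c1 c2 two]>>];
  rewrite -[<<_>>]/(M : {set _}).
have Ma : elt4 a1 a2 two \in M by apply: mem_gen; rewrite !inE eqxx.
have Mc : elt4 c1 c2 two \in M by apply: mem_gen; rewrite !inE eqxx orbT.
have [Ma1 Ma2] := split_factors M _ _ a1_even co_a Ma.
have [Mc1 Mc2] := split_factors M _ _ c1_even co_c Mc.
have Mright y : elt4 1 y 1 \in M.
  apply: (gen_preim _ _ (Morphism elt4_right_morph) M _ gen2) => z /=.
  by rewrite !inE => /orP[] /eqP ->.
have Mleft x : elt4 x 1 1 \in M.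
  have Mprod u v : elt4 u 1 two \in M -> elt4 v 1 two \in M ->
      elt4 (u * v) 1 1 \in M.
    by move=> Mu Mv; have := groupM Mu Mv; rewrite elt4M_even // two_two mulg1.
  apply: (gen_preim _ _ (Morphism elt4_left_morph) M _ gen1) => z /=.
  rewrite !inE -orbA => /or3P[] /eqP ->.
  - exact: (Mprod a1 a1 Ma1 Ma1).
  - exact: (Mprod a1 c1 Ma1 Mc1).
  exact: (Mprod c1 c1 Mc1 Mc1).
have Mtwo : elt4 1 1 two \in M.
  by have := groupM (Mleft a1^-1) Ma1; rewrite elt4M_even ?mul1g ?mulVg.
apply/subsetP=> _ /wr2P[x [y [k [k2 ->]]]].
have -> : elt4 x y k = elt4 x 1 1 * elt4 1 y 1 * elt4 1 1 k.
  by rewrite !elt4M_even ?groupM ?group1 // !mulg1 !mul1g.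
apply: groupM; first exact: groupM (Mleft x) (Mright y).
by move: k2; rewrite cycle_two !inE => /orP[] /eqP ->.
Qed.

End Elt4.

(** * Mixed Beauville structures on H_[4] *)

Theorem lemma4p5 (H : finGroupType) (a1 c1 a2 c2 : H) :
  [set: H] != 1 ->
  ~~ odd #[a1] -> ~~ odd #[c1] ->
  <<[set a2; c2]>> = [set: H] ->
  coprime (nu a1 c1) (nu a2 c2) ->
  let G := [set: wr4 H]%G in
  let G0 := wr2 H in
  let a := elt4 a1 a2 2%:R%R in
  let c := elt4 c1 c2 2%:R%R in
  (<<[set a1 ^+ 2; a1 * c1; c1 ^+ 2]>> = [set: H] ->
     mixed_Beauville G G0 a c) /\
  ([~: [set: H], [set: H]] = [set: H] ->
   <<[set a1; c1]>> = [set: H] ->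
     mixed_Beauville G G0 a c).
Proof.
move=> _ a1_even c1_even gen2 co_nu G G0 a c.
have main : <<[set a1 ^+ 2; a1 * c1; c1 ^+ 2]>> = [set: H] ->
    mixed_Beauville G G0 a c; last first.
  split=> // perfH gen_ac; apply: main; apply/eqP.
  by rewrite eqEsubset subsetT -{1}perfH der1_sub_even_words.
move=> gen1.
have two2 : (2%:R%R : 'Z_4) \in <[2%:R%R : 'Z_4]> by apply: cycle_id.
have nu_parity (u v : H) : #[v] %| nu a2 c2 -> #[u] = #[v] -> odd #[u].
  move=> v_nu ->; have co2 : coprime 2 (nu a2 c2).
    apply: coprime_dvdl co_nu; rewrite /nu -mulnA dvdn_mulr //.
    by rewrite dvdn2.
  by move: (coprime_dvdr v_nu co2); rewrite coprime2n.
split.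
  split; rewrite ?subsetT ?mem_wr2 //; last exact: (index_wr2 H).
  apply/eqP=> G1; have := dvdn_indexg G G0.
  by rewrite (index_wr2 H) G1 cards1.
(* [1%R] is a generator of Z/4Z, unlike the group identity 1. *)
pose g := elt4 (1 : H) 1 (1%R : 'Z_4).
have g_swap x y k :
    k \in <[2%:R%R : 'Z_4]> -> lconj g (elt4 x y k) = elt4 y x k.
  move=> k2; apply: (mulIg g); rewrite /lconj mulgKV /g elt4M elt4M_even //=.
  by rewrite !mulg1 !mul1g [(k * _)]Zp_mulgC.
exists g; first by rewrite inE.
split.
- exact: gen_wr2.
- apply/wr2P=> -[x [y [k [k2]]]].
  move/(@elt4_inj _ (1, 1, 1%R) (x, y, k)) => [_ _ kE].
  by have := odd_cycle_two k k2; rewrite -kE.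
- move=> _ /wr2P[u [v [k [k2 ->]]]]; apply/negP.
  have -> : g * elt4 u v k * g * elt4 u v k = elt4 (v * u) (u * v) 2%:R%R.
    rewrite -mulgA; move: k2; rewrite cycle_two !inE => /orP[] /eqP ->;
      by rewrite /g !elt4M /= !mul1g; congr elt4; apply: val_inj.
  case/Sigma_elt4=> x [y [l [E _ y_nu /(_ a1_even c1_even)]]].
  have [Ex Ey <-] := @elt4_inj _ (_, _, _) (x, y, l) E.
  have x_odd : odd #[x] by apply: nu_parity y_nu _; rewrite -Ex -Ey order_mulC.
  by rewrite x_odd => /(_ isT).
apply/eqP; rewrite eqEsubset; apply/andP; split; last first.
  by rewrite sub1set inE !Sigma1.
apply/subsetP=> z; rewrite !g_swap // !inE => /andP[].
case/Sigma_elt4=> x [y [k [-> x_nu y_nu par]]].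
case/Sigma_elt4=> x' [y' [k' [E x'_nu y'_nu _]]].
have [Ex Ey _] := @elt4_inj _ (x, y, k) (x', y', k') E.
move: x'_nu y'_nu; rewrite -Ex -Ey => x_nu' y_nu'.
rewrite coprime_sym in co_nu.
have Ex1 := dvdn_coprime_order _ _ _ _ co_nu x_nu' x_nu.
have Ey1 := dvdn_coprime_order _ _ _ _ co_nu y_nu y_nu'.
case: (eqVneq k 1) => [-> | /(par a1_even c1_even)].
  by rewrite Ex1 Ey1 elt4_1.
by rewrite Ex1 order1.
Qed.
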